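(* Let $Z$ be a uniformly convex Banach space satisfying Opial's condition, let $W \subset Z$ be a nonempty closed convex subset, and let $K : W \to W$ be a nonexpansive mapping with $F(K) \neq \emptyset$. Let $a, b \in (0,1)$ and let $\{\alpha_n\}$, $\{\beta_n\}$ be sequences with $\alpha_n, \beta_n \in (a,b) \subset (0,1)$ for all $n \in \mathbb{N}$. Let $s_1 \in W$ and let $\{s_n\}$ be defined for all $n \in \mathbb{N}$ by $$r_n = (1-\beta_n)s_n + \beta_n K s_n, \qquad s_{n+1} = (1-\alpha_n) r_n + \alpha_n K s_n .$$ Then $\{s_n\}$ converges weakly to a fixed point of $K$.
   Context: $F(K) = \{w \in W : Kw = w\}$ denotes the set of fixed points of $K$. $K : W \to W$ is nonexpansive if $\|Kx - Ky\| \le \|x-y\|$ for all $x,y \in W$. A Banach space $Z$ satisfies Opial's condition if, whenever a sequence $\{x_n\}$ in $Z$ converges weakly to $x \in Z$, one has $\limsup_{n\to\infty}\|x_n - x\| < \limsup_{n\to\infty}\|x_n - t\|$ for every $t \in Z$ with $t \neq x$. *)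

(* Defs.v *)
From mathcomp Require Import all_boot all_order all_algebra.
From mathcomp Require Import all_classical all_reals all_analysis.

Set Implicit Arguments.
Unset Strict Implicit.
Unset Printing Implicit Defensive.

Import Order.TTheory GRing.Theory Num.Theory.
Import numFieldNormedType.Exports.

Local Open Scope classical_set_scope.
Local Open Scope ring_scope.

(* Banach spaces are real: [Z : completeNormedModType R] with [R : realType]. *)

Definition uniformly_convex (R : realType) (Z : normedModType R) : Prop :=
  forall eps : R, 0 < eps <= 2 -> exists2 delta : R, 0 < delta &
    forall x y : Z, `|x| <= 1 -> `|y| <= 1 -> eps <= `|x - y| ->
      `|2^-1 *: (x + y)| <= 1 - delta.

(* The continuous dual is not packaged in the library; it is quantified over
   as the continuous linear maps into [R^o], the scalars as a normed module. *)
Definition weakly_cvg (R : realType) (Z : normedModType R)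
    (x : nat -> Z) (l : Z) : Prop :=
  forall f : {linear Z -> R^o}, continuous f -> f (x n) @[n --> \oo] --> f l.

(* The limsup is taken in [\bar R], where it is defined for all sequences
   ([limn_sup] is only meaningful for bounded ones). *)
Definition opial_condition (R : realType) (Z : normedModType R) : Prop :=
  forall (x : nat -> Z) (l : Z), weakly_cvg x l -> forall t : Z, t <> l ->
    (limn_esup (fun n => `|x n - l|%:E) < limn_esup (fun n => `|x n - t|%:E))%E.

Definition nonexpansive (R : realType) (Z : normedModType R) (W : set Z)
    (K : {fun W >-> W}) : Prop :=
  forall x y : Z, W x -> W y -> `|K x - K y| <= `|x - y|.

Definition fixed_points (R : realType) (Z : normedModType R) (W : set Z)
    (K : {fun W >-> W}) : set Z :=
  [set w | W w /\ K w = w].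

(* Main.v *)
(* Eliminating [r] turns the scheme into the Mann iteration
   [s_(n+1) = (1 - g_n) s_n + g_n K s_n] with
   [g_n = 1 - (1 - alpha_n)(1 - beta_n)] bounded away from 0 and 1.  The
   distances from [s_n] to a fixed point decrease, so uniform convexity gives
   [|s_n - K s_n| -> 0].  Opial's condition then makes every weak limit of a
   subsequence a fixed point, and makes two such limits equal.

   Weak sequential compactness is obtained without duality.  In a uniformly
   convex Banach space a decreasing sequence of nonempty closed convex sets
   meeting a fixed ball has a common point.  Hence the intersection [C] of the
   closed convex hulls of the tails of a bounded sequence is nonempty.  Passing
   to a subsequence shrinks [C]; a diagonal argument over countably many balls
   gives a subsequence whose [C] no longer shrinks.  Each point [p] of this [C]
   is then a weak limit: if a half-space missing [p] contained infinitely many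
   terms, it would contain the [C] of a further subsequence, hence [p].

   Only midpoints are used in this argument, so convexity is replaced
   throughout by stability under midpoints. *)

Require Import Defs.
From mathcomp Require Import all_boot all_order all_algebra.
From mathcomp Require Import all_classical all_reals all_analysis.
From mathcomp Require Import ring lra.

Set Implicit Arguments.
Unset Strict Implicit.
Unset Printing Implicit Defensive.

Import Order.TTheory GRing.Theory Num.Theory.
Import numFieldNormedType.Exports.

Local Open Scope classical_set_scope.
Local Open Scope ring_scope.

(** * Uniform convexity and nested midpoint-closed sets *)

Definition mid (R : realType) (Z : normedModType R) (x y : Z) : Z :=
  2^-1 *: (x + y).

Definition mid_closed (R : realType) (Z : normedModType R) (A : set Z) : Prop :=
  closed A /\ forall x y, A x -> A y -> A (mid x y).

(** Rescaling by [rho] gives a gain of [d * rho]. Since [eps <= |x - y| <= 2 * rho], this is at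
    least [d * (eps / 2)], so [eta] can be chosen uniformly in [rho <= M]. *)
Lemma uniformly_convex_mid (R : realType) (Z : normedModType R) (M eps : R) :
    uniformly_convex Z -> 0 < M -> 0 < eps ->
  exists2 eta, 0 < eta & forall rho (x y : Z), rho <= M ->
    `|x| <= rho -> `|y| <= rho -> eps <= `|x - y| -> `|mid x y| <= rho - eta.
Proof.
move=> uc M0 e0; have [e2M|e2M] := leP eps (2 * M); last first.
  exists 1 => // rho x y rM xr yr /le_trans /(_ (ler_normB _ _)); lra.
have eM : 0 < eps / M <= 2 by rewrite divr_gt0//= ler_pdivrMr.
have [d d0 H] := uc _ eM.
exists (d * (eps / 2)) => [|rho x y rM xr yr exy].
  by rewrite mulr_gt0// divr_gt0.
have rho_ge : eps / 2 <= rho.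
  by have := le_trans exy (ler_normB _ _); lra.
have rho0 : 0 < rho by lra.
have {}H : `|2^-1 *: (rho^-1 *: x + rho^-1 *: y)| <= 1 - d.
  apply: H.
  - by rewrite normrZ gtr0_norm ?invr_gt0// ler_pdivrMl// mulr1.
  - by rewrite normrZ gtr0_norm ?invr_gt0// ler_pdivrMl// mulr1.
  - rewrite -scalerBr normrZ gtr0_norm ?invr_gt0// [leRHS]mulrC.
    by rewrite ler_pM ?lef_pV2 ?posrE// ?invr_ge0 ltW.
have -> : mid x y = rho *: (2^-1 *: (rho^-1 *: x + rho^-1 *: y)).
  by rewrite -scalerDr !scalerA mulrCA divff ?mulr1// gt_eqF.
rewrite normrZ gtr0_norm//.
have : rho * `|2^-1 *: (rho^-1 *: x + rho^-1 *: y)| <= rho * (1 - d).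
  by rewrite ler_pM2l.
have : d * (eps / 2) <= d * rho by rewrite ler_pM2l.
lra.
Qed.

(** Points [z n] of almost minimal norm in [T n] form a Cauchy sequence: the midpoint of [z m] and a
    later [z n] stays in [T m], so its norm is at least the infimum [d m], which uniform convexity
    forbids when the two points are far apart. *)
Lemma mid_closed_bigcap_neq0 (R : realType) (Z : completeNormedModType R)
    (T : nat -> set Z) (M : R) : uniformly_convex Z ->
    (forall m, mid_closed (T m)) -> (forall m n, (m <= n)%N -> T n `<=` T m) ->
    (forall m, exists2 z, T m z & `|z| <= M) ->
  exists p, forall m, T m p.
Proof.
move=> uc Tmid Tdec TM.
pose N m := [set `|z| | z in T m].
have N_lb m : has_lbound (N m) by exists 0 => _ [z _ <-].
have N_neq0 m : N m !=set0.
  by have [z Tz _] := TM m; exists `|z|; exists z.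
pose d m := inf (N m).
have d_le m z : T m z -> d m <= `|z|.
  by move=> Tz; apply: ge_inf => //; exists z.
have dM m : d m <= M by have [z /d_le + zM] := TM m; move/le_trans; exact.
have d_nd m n : (m <= n)%N -> d m <= d n.
  move=> mn; apply: lb_le_inf => // _ [z /(Tdec _ _ mn) Tz <-]; exact: d_le.
have /choice[z zT] m : exists z, T m z /\ `|z| < d m + m.+1%:R^-1.
  have m0 : 0 < m.+1%:R^-1 :> R by [].
  have [_ [z Tz <-] H] := inf_adherent m0 (conj (N_neq0 m) (N_lb m)).
  by exists z.
have M0 : 0 <= M by have [z0 _ /(le_trans (normr_ge0 _))] := TM 0%N.
(* [sup d] is approached by the [d m], which pins the norms of far away [z n]
   and of their midpoints. *)
have d_sup : has_sup (range d).
  by split; [exists (d 0%N); exists 0%N|exists M => _ [m _ <-]].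
pose D := sup (range d).
have d_leD m : d m <= D by apply: ub_le_sup; [exact: d_sup.2|exists m].
have DM : D <= M by apply: ge_sup; [exact: d_sup.1|move=> _ [m _ <-]].
have zC : forall eps, 0 < eps ->
    exists m, forall n, (m <= n)%N -> `|z m - z n| < eps.
  move=> eps e0.
  have M10 : 0 < M + 1 by lra.
  have [eta eta0 H] := uniformly_convex_mid uc M10 e0.
  (* With a tolerance of at most [eta / 4], the midpoint would have norm at most [D - 3 * eta / 4],
     below [d m > D - eta / 4]. The cap 1 keeps the radius within [M + 1]. *)
  have eta40 : 0 < Num.min (eta / 4) 1.
    by rewrite lt_min; apply/andP; split=> //; lra.
  have [_ [m0 _ <-] Dm0] := sup_adherent eta40 d_sup.
  have [m1 _ Hm1] := near_infty_natSinv_lt (PosNum eta40).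
  pose m := maxn m0 m1.
  have dm : D - Num.min (eta / 4) 1 < d m.
    by apply: lt_le_trans Dm0 _; apply: d_nd; exact: leq_maxl.
  have mN n : (m <= n)%N -> n.+1%:R^-1 < Num.min (eta / 4) 1 :> R.
    by move=> mn; apply: Hm1; rewrite /= (leq_trans _ mn)// leq_maxr.
  have zn n : (m <= n)%N -> `|z n| <= D + Num.min (eta / 4) 1.
    by move=> /mN/ltW nm; apply: le_trans (ltW (zT n).2) _; rewrite lerD.
  have mine : Num.min (eta / 4) 1 <= eta / 4 by rewrite ge_min lexx.
  have min1 : Num.min (eta / 4) 1 <= 1 :> R by rewrite ge_min lexx orbT.
  exists m => n mn; rewrite ltNge; apply/negP => /H
    -/(_ (D + Num.min (eta / 4) 1)).
  have /d_le : T m (mid (z m) (z n)).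
    by apply: (Tmid m).2; [exact: (zT m).1|apply: Tdec mn _ (zT n).1].
  move=> + /(_ _ (zn _ (leqnn m)) (zn _ mn)); lra.
have /cauchy_cvgP/cvg_ex[p zp] : cauchy (z n @[n --> \oo]).
  apply/cauchy_exP => e e0; have [m Hm] := zC _ e0.
  exists (z m); exists m => // n /= mn.
  by rewrite -ball_normE; exact: Hm.
exists p => m; apply: (closed_cvg _ (Tmid m).1 _ _ zp).
exists m => // n /= mn; apply: Tdec mn _ (zT n).1.
Qed.

(** * Subsequences and diagonal extraction *)

(* Subsequences of [x] are represented by [x \o phi] with [phi] inflating:
   terms may be repeated or reordered, which does not affect limits. *)
Definition inflating (phi : nat -> nat) : Prop := forall n, (n <= phi n)%N.

Lemma inflating_id : inflating id. Proof. by []. Qed.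
#[local] Hint Resolve inflating_id : core.

Lemma inflating_comp (phi psi : nat -> nat) :
  inflating phi -> inflating psi -> inflating (phi \o psi).
Proof. by move=> ph ps n; exact: leq_trans (ps n) (ph _). Qed.

Lemma inflating_cvg (phi : nat -> nat) :
  inflating phi -> phi n @[n --> \oo] --> \oo.
Proof.
by move=> ph; apply/cvgnyPge => N; exists N => // n /= /leq_trans; exact.
Qed.

Lemma frequently_inflating (P : nat -> Prop) :
    ~ (\forall n \near \oo, ~ P n) ->
  exists2 psi, inflating psi & forall n, P (psi n).
Proof.
move=> nP; have /choice[psi H] n : exists m, (n <= m)%N /\ P m.
  apply: contrapT => H; apply: nP; exists n => // m /= nm Pm.
  by apply: H; exists m.
by exists psi => n; have [] := H n.
Qed.

(** Stage [k] refines to a subsequence with [Q k] whenever one exists. If a subsequence of the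
    diagonal has [Q k], stage [k] could succeed, hence did; the diagonal, eventually a subsequence
    of that stage, inherits [Q k]. *)
Lemma diagonal_subsequence (Q : nat -> (nat -> nat) -> Prop) :
    (forall k phi phi' psi, inflating psi ->
      (\forall n \near \oo, phi' n = phi (psi n)) -> Q k phi -> Q k phi') ->
  exists2 delta, inflating delta &
    forall k psi, inflating psi -> Q k (delta \o psi) -> Q k delta.
Proof.
move=> Q_sub.
have /choice[S S_spec] : forall kphi : nat * (nat -> nat), exists psi,
    inflating psi /\ ((exists2 chi, inflating chi & Q kphi.1 (kphi.2 \o chi)) ->
      Q kphi.1 (kphi.2 \o psi)).
  move=> [k phi] /=.
  have [[chi chi_infl Qchi]|nQ] :=
      pselect (exists2 chi, inflating chi & Q k (phi \o chi)).
    by exists chi.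
  by exists id; split.
pose Phi := fix Phi k := if k is j.+1 then Phi j \o S (j, Phi j) else id.
have Phi_tail k n : exists g, inflating g /\ Phi (n + k)%N = Phi k \o g.
  elim: n => [|n [g [g_infl gE]]]; first by exists id.
  exists (g \o S ((n + k)%N, Phi (n + k)%N)); split.
    by apply: inflating_comp => //; exact: (S_spec _).1.
  by rewrite addSn /= gE.
pose delta n := Phi n n.
have delta_tail k : exists2 psi, inflating psi &
    forall n, (k <= n)%N -> delta n = Phi k (psi n).
  have /choice[G HG] := Phi_tail k.
  (* The value [n] below [k] only keeps the reindexing inflating. *)
  exists (fun n => if (k <= n)%N then G (n - k)%N n else n) => [n|n kn].
    by case: ifP => // _; exact: (HG _).1.
  by rewrite kn /delta -{1}(subnK kn) (HG _).2.
exists delta => [n|k psi psi_infl Qpsi].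
  by have [g g_infl /(_ n (leq0n n)) ->] := delta_tail 0%N; exact: g_infl.
have QPhi : Q k (Phi k.+1).
  apply: (S_spec (k, Phi k)).2 => /=.
  have [g g_infl gE] := delta_tail k.
  exists (g \o psi); first exact: inflating_comp.
  apply: (Q_sub _ (delta \o psi) _ id) => //.
  exists k => // n /= kn; rewrite gE//; exact: leq_trans (psi_infl n).
have [g g_infl gE] := delta_tail k.+1.
by apply: (Q_sub _ (Phi k.+1) _ g) => //; exists k.+1.
Qed.

(** * Cluster hulls and weak sequential compactness *)

(* For bounded sequences in a reflexive space, this is the closed convex hull
   of the set of weak cluster points. *)
Definition cluster_hull (R : realType) (Z : normedModType R) (x : nat -> Z) :
    set Z :=
  [set p | forall A, mid_closed A -> (\forall n \near \oo, A (x n)) -> A p].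

Lemma cluster_hull_subsequence (R : realType) (Z : normedModType R)
    (x y : nat -> Z) (psi : nat -> nat) : inflating psi ->
  (\forall n \near \oo, y n = x (psi n)) -> cluster_hull y `<=` cluster_hull x.
Proof.
move=> psi_infl yx p yp A Amid Ax; apply: yp => //.
have := inflating_cvg psi_infl Ax; rewrite /= !near_simpl => Axp.
by near=> n; rewrite (near yx n)//; near: n.
Unshelve. all: by end_near. Qed.

Lemma cluster_hull_neq0 (R : realType) (Z : completeNormedModType R)
    (x : nat -> Z) (M : R) :
  uniformly_convex Z -> (forall n, `|x n| <= M) -> cluster_hull x !=set0.
Proof.
move=> uc xM.
pose T m := [set p | forall A, mid_closed A ->
  (forall n, (m <= n)%N -> A (x n)) -> A p].
have Tx m n : (m <= n)%N -> T m (x n) by move=> mn A _; exact.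
have Tmid m : mid_closed (T m).
  split=> [p Tp A Amid xA|p q Tp Tq A Amid xA]; last first.
    by apply: Amid.2; [exact: Tp|exact: Tq].
  apply: Amid.1; apply: closure_subset Tp => q; exact.
have Tdec m n : (m <= n)%N -> T n `<=` T m.
  move=> mn p Tp A Amid xA; apply: Tp => // k nk.
  by apply: xA; exact: leq_trans nk.
have [m|p Tp] := mid_closed_bigcap_neq0 (M := M) uc Tmid Tdec.
  by exists (x m) => //; exact: Tx.
exists p => A Amid [N _ NA]; exact: (Tp N).
Qed.

Lemma closure_normP (R : realType) (Z : normedModType R) (A : set Z) (p : Z) :
  closure A p <-> forall e, 0 < e -> exists2 a, A a & `|p - a| < e.
Proof.
split=> [Ap e e0|H B /nbhs_ballP[e e0 eB]].
  have [a [Aa]] := Ap _ (nbhsx_ballx p e e0).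
  by rewrite -ball_normE; exists a.
have [a Aa pa] := H _ e0; exists a; split => //.
by apply: eB; rewrite -ball_normE.
Qed.

(** Iterated midpoints are indexed by trees because [GenTree.tree nat] is countable; nodes that are
    not binary get the junk value [x 0]. *)
Fixpoint tree_mid (R : realType) (Z : normedModType R) (x : nat -> Z)
    (t : GenTree.tree nat) : Z :=
  match t with
  | GenTree.Leaf n => x n
  | GenTree.Node _ [:: t1; t2] => mid (tree_mid x t1) (tree_mid x t2)
  | GenTree.Node _ _ => x 0%N
  end.

(** This closure contains the cluster hull of every subsequence of [x], so countably many balls
    centred at the [d i] suffice for the diagonal argument. *)
Lemma countable_dense_mid_closed (R : realType) (Z : normedModType R)
    (x : nat -> Z) : exists d : nat -> Z,
  mid_closed (closure (range d)) /\ forall n, closure (range d) (x n).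
Proof.
pose d k := tree_mid x (odflt (GenTree.Leaf 0%N) (unpickle k)).
have dE t : d (pickle t) = tree_mid x t by rewrite /d pickleK.
exists d; split; last first.
  move=> n; apply: subset_closure.
  exists (pickle (GenTree.Leaf n)); first by [].
  by rewrite dE.
split; first exact: closed_closure.
move=> p q /closure_normP Hp /closure_normP Hq; apply/closure_normP => e e0.
have [_ [i _ <-] pi] := Hp _ e0; have [_ [j _ <-] qj] := Hq _ e0.
exists (mid (d i) (d j)).
  exists (pickle (GenTree.Node 0
    [:: odflt (GenTree.Leaf 0%N) (unpickle i);
        odflt (GenTree.Leaf 0%N) (unpickle j)])); first by [].
  by rewrite dE.
rewrite -scalerBr normrZ gtr0_norm ?invr_gt0// opprD addrACA.
have := ler_normD (p - d i) (q - d j); lra.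
Qed.

Lemma avoiding_subsequence (R : realType) (Z : completeNormedModType R)
    (x : nat -> Z) (M : R) : uniformly_convex Z -> (forall n, `|x n| <= M) ->
  exists2 phi, inflating phi & exists p, forall A, mid_closed A -> ~ A p ->
    \forall n \near \oo, ~ A (x (phi n)).
Proof.
move=> uc xM; have [d [d_mid dx]] := countable_dense_mid_closed x.
(* The index [k] codes a centre [d i] and a radius [1 / (m + 1)]; [Q k phi] says that the hull along
   [phi] misses this ball. *)
pose B k := let im := odflt (0, 0)%N (unpickle k) in
  [set z | `|z - d im.1| < im.2.+1%:R^-1].
pose Q k phi := cluster_hull (x \o phi) `&` B k `<=` set0.
have Q_sub k phi phi' psi : inflating psi ->
    (\forall n \near \oo, phi' n = phi (psi n)) -> Q k phi -> Q k phi'.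
  move=> psi_infl phi'E; apply: subset_trans; apply: setSI.
  apply: (cluster_hull_subsequence psi_infl).
  by apply: filterS phi'E => n /= ->.
have [phi phi_infl phiQ] := diagonal_subsequence Q_sub.
have [p xp] := cluster_hull_neq0 uc (fun n => xM (phi n)).
exists phi => //; exists p => A Amid nAp.
apply: contrapT => /frequently_inflating[] psi psi_infl Apsi.
have dp : closure (range d) p by apply: xp d_mid _; exact: nearW.
have [e e0 pA] : exists2 e, 0 < e & forall z, `|p - z| < e -> ~ A z.
  apply: contrapT => H; apply: nAp; apply: Amid.1; apply/closure_normP => e e0.
  apply: contrapT => He; apply: H; exists e => // z pz Az; apply: He.
  by exists z.
(* A ball of radius below [e / 2] containing [p] lies within [e] of [p], so it misses [A] and hence
   the hull along [phi \o psi]. By the choice of [phi] it then misses the hull along [phi], which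
   contains [p]. *)
have e20 : 0 < e / 2 by rewrite divr_gt0.
have [m _ /(_ m (leqnn m)) me] := near_infty_natSinv_lt (PosNum e20).
have m0 : 0 < m.+1%:R^-1 :> R by [].
have [_ [i _ <-] pi] := (closure_normP _ _).1 dp _ m0.
have := phiQ (pickle (i, m)) psi psi_infl.
have BE : B (pickle (i, m)) = [set z | `|z - d i| < m.+1%:R^-1].
  by rewrite /B pickleK.
rewrite /Q BE => H; apply: (H _ p); last by split.
move=> z [zc zd]; apply: (pA z); last by apply: zc => //; exact: nearW.
apply: (le_lt_trans (ler_distD (d i) _ _)); rewrite [ltRHS](splitr e).
by rewrite ltrD// ?(lt_trans _ me)// distrC.
Qed.

(** The last clause later places the weak limit in [W]. *)
Lemma weakly_cvg_subsequence (R : realType) (Z : completeNormedModType R)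
    (x : nat -> Z) (M : R) : uniformly_convex Z -> (forall n, `|x n| <= M) ->
  exists2 phi, inflating phi & exists p, weakly_cvg (x \o phi) p /\
    forall A, mid_closed A -> (forall n, A (x n)) -> A p.
Proof.
move=> uc xM; have [phi phi_infl [p xp]] := avoiding_subsequence uc xM.
exists phi => //; exists p; split; last first.
  move=> A Amid Ax; apply: contrapT => /(xp A Amid) [N _ /(_ N (leqnn N))].
  by apply; exact: Ax.
move=> f f_cont; apply/cvgrPdist_lt => e e0.
(* The half-spaces [f z <= f p - e] and [f p + e <= f z] miss [p], so the subsequence eventually
   leaves both. *)
have halfspace (c : R) :
    mid_closed [set z | c <= f z] /\ mid_closed [set z | f z <= c].
  have f_mid z z' : f (mid z z') = 2^-1 * (f z + f z').
    by rewrite linearZ linearD.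
  split; split.
  - apply: (@preimage_closed _ _ f [set y | c <= y]) => [z _|].
      exact: f_cont.
    exact: closed_ge.
  - by move=> z z' /=; rewrite f_mid; lra.
  - apply: (@preimage_closed _ _ f [set y | y <= c]) => [z _|].
      exact: f_cont.
    exact: closed_le.
  - by move=> z z' /=; rewrite f_mid; lra.
have lo : ~ (f p <= f p - e) by apply/negP; rewrite -ltNge; lra.
have hi : ~ (f p + e <= f p) by apply/negP; rewrite -ltNge; lra.
have := xp _ (halfspace _).1 hi; have := xp _ (halfspace _).2 lo.
apply: filterS2 => n /= /negP + /negP; rewrite -!ltNge => lo' hi'.
by rewrite distrC ltr_norml; apply/andP; split; lra.
Qed.

(** * Convex combinations and Opial's condition *)

Lemma convex_set_comb (R : realType) (Z : normedModType R) (W : set Z)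
    (x y : Z) (h : R) : convex_set W ->
  0 <= h <= 1 -> W x -> W y -> W ((1 - h) *: x + h *: y).
Proof.
move=> W_convex /andP[h0 h1] Wx Wy; rewrite addrC.
by have := W_convex y x (Itv01 h0 h1); rewrite !inE => H; exact: H.
Qed.

(** The last hypothesis bounds the limsup of [|x n - t|] by that of [|x n - l|], which Opial's
    condition forbids unless [t = l]. *)
Lemma opial_norm (R : realType) (Z : normedModType R) (x : nat -> Z) (l t : Z) :
    opial_condition Z -> weakly_cvg x l ->
    (forall e, 0 < e -> \forall n \near \oo, `|x n - t| <= `|x n - l| + e) ->
  t = l.
Proof.
move=> opial xl H; apply: contrapT => /(opial x l xl); apply/negP.
rewrite -leNgt.
have esup_inf (u : nat -> \bar R) : limn_esup u = ereal_inf (range (esups u)).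
  by rewrite limn_esup_lim; apply/cvg_lim => //; exact: cvg_esups_inf.
rewrite [leRHS]esup_inf; apply: le_ereal_inf_tmp => _ [N _ <-].
have x_le n : (N <= n)%N ->
    (`|x n - l|%:E <= esups (fun n => `|x n - l|%:E) N)%E.
  by move=> Nn; apply: ereal_sup_ubound; exists n.
apply/lee_addgt0Pr => e e0; rewrite esup_inf.
have [N' _ HN'] := H _ e0.
apply: (@le_trans _ _ (esups (fun n => `|x n - t|%:E) (maxn N N'))).
  by apply: ereal_inf_lbound; exists (maxn N N').
apply: ge_ereal_sup => _ [n /= + <-]; rewrite geq_max => /andP[Nn N'n].
apply: le_trans (leeD2r _ (x_le n Nn)).
by rewrite -EFinD lee_fin; exact: HN'.
Qed.

Lemma uniformly_convex_comb (R : realType) (Z : normedModType R) (M eps c : R) :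
    uniformly_convex Z -> 0 < M -> 0 < eps -> 0 < c ->
  exists2 eta, 0 < eta & forall rho g (x y : Z), rho <= M -> c <= g <= 1 - c ->
    `|x| <= rho -> `|y| <= rho -> eps <= `|x - y| ->
    `|(1 - g) *: x + g *: y| <= rho - eta.
Proof.
move=> uc M0 e0 c0; have [eta eta0 H] := uniformly_convex_mid uc M0 e0.
(* The combination is a convex combination of the midpoint, with weight at
   least [2 c], and of one of the end points. *)
have comb rho h (x z : Z) : `|x| <= rho -> `|z| <= rho - eta ->
    c <= h <= 1 / 2 ->
    `|(1 - 2 * h) *: x + (2 * h) *: z| <= rho - 2 * c * eta.
  move=> xr zr /andP[ch h2]; apply: le_trans (ler_normD _ _) _.
  have [h20 h10] : 0 <= 2 * h /\ 0 <= 1 - 2 * h by split; lra.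
  rewrite 2!normrZ (ger0_norm h20) (ger0_norm h10).
  have : (1 - 2 * h) * `|x| <= (1 - 2 * h) * rho by rewrite ler_wpM2l//; lra.
  have : 2 * h * `|z| <= 2 * h * (rho - eta) by rewrite ler_wpM2l//; lra.
  have : c * eta <= h * eta by rewrite ler_pM2r.
  lra.
exists (2 * c * eta) => [|rho g x y rM /andP[cg gc] xr yr exy].
  by rewrite !mulr_gt0.
have mr := H _ _ _ rM xr yr exy.
have [g2|g2] := leP g (1 / 2).
  have -> : (1 - g) *: x + g *: y = (1 - 2 * g) *: x + (2 * g) *: mid x y.
    rewrite /mid scalerA scalerDr addrA -scalerDl.
    by congr (_ *: _ + _ *: _); field.
  by apply: comb => //; rewrite cg.
have -> : (1 - g) *: x + g *: y =
    (1 - 2 * (1 - g)) *: y + (2 * (1 - g)) *: mid x y.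
  rewrite /mid scalerA [x + y]addrC scalerDr addrA -scalerDl addrC.
  by congr (_ *: _ + _ *: _); field.
by apply: comb => //; apply/andP; split; lra.
Qed.

(** * The Mann iteration *)

Lemma fejer_cvg (R : realType) (Z : normedModType R) (s : nat -> Z) (q : Z) :
    (forall n, `|s n.+1 - q| <= `|s n - q|) ->
  exists L : R, `|s n - q| @[n --> \oo] --> L.
Proof.
move=> s_dec; apply/cvg_ex; apply: nonincreasing_is_cvgn.
  by apply/nonincreasing_seqP.
by exists 0 => _ [n _ <-].
Qed.

Lemma mann_sub (R : realType) (Z : normedModType R) (W : set Z)
    (K : {fun W >-> W}) (g : nat -> R) (c : R) (s : nat -> Z) :
    convex_set W ->
    0 < c -> (forall n, c <= g n <= 1 - c) -> W (s 0%N) ->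
    (forall n, s n.+1 = (1 - g n) *: s n + g n *: K (s n)) ->
  forall n, W (s n).
Proof.
move=> W_convex c0 g_c s_init sE.
elim=> // n IH; rewrite sE; apply: convex_set_comb => //.
  by have /andP[? ?] := g_c n; apply/andP; split; lra.
exact: funS.
Qed.

(** As [K q = q], the vector [s n.+1 - q] is a convex combination of [s n - q] and [K (s n) - K q],
    neither longer than [s n - q]. *)
Lemma mann_fejer (R : realType) (Z : normedModType R) (W : set Z)
    (K : {fun W >-> W}) (g : nat -> R) (c : R) (s : nat -> Z) (q : Z) :
    convex_set W -> nonexpansive K ->
    0 < c -> (forall n, c <= g n <= 1 - c) -> W (s 0%N) ->
    (forall n, s n.+1 = (1 - g n) *: s n + g n *: K (s n)) ->
    fixed_points K q ->
  forall n, `|s n.+1 - q| <= `|s n - q|.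
Proof.
move=> W_convex K_ne c0 g_c s_init sE [Wq Kq] n.
have Ws := mann_sub W_convex c0 g_c s_init sE.
have -> : s n.+1 - q = (1 - g n) *: (s n - q) + g n *: (K (s n) - K q).
  rewrite sE Kq !scalerBr addrACA -opprD -[X in _ = _ - X]scalerDl subrK.
  by rewrite scale1r.
apply: le_trans (ler_normD _ _) _; have /andP[cg gc] := g_c n.
have [g0 g1] : 0 <= g n /\ 0 <= 1 - g n by split; lra.
rewrite 2!normrZ (ger0_norm g0) (ger0_norm g1).
have : g n * `|K (s n) - K q| <= g n * `|s n - q|.
  by rewrite ler_wpM2l//; exact: K_ne.
lra.
Qed.

(** Whenever [|s n - K (s n)| >= e], uniform convexity lowers the distance to [q] by a fixed [eta],
    which cannot happen late in a convergent sequence of distances. *)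
Lemma mann_asymptotically_regular (R : realType) (Z : normedModType R)
    (W : set Z) (K : {fun W >-> W}) (g : nat -> R) (c : R) (s : nat -> Z)
    (q : Z) :
    uniformly_convex Z -> convex_set W -> nonexpansive K ->
    0 < c -> (forall n, c <= g n <= 1 - c) -> W (s 0%N) ->
    (forall n, s n.+1 = (1 - g n) *: s n + g n *: K (s n)) ->
    fixed_points K q ->
  `|s n - K (s n)| @[n --> \oo] --> 0.
Proof.
move=> uc W_convex K_ne c0 g_c s_init sE Fq; have [Wq Kq] := Fq.
have Ws := mann_sub W_convex c0 g_c s_init sE.
have s_fejer := mann_fejer W_convex K_ne c0 g_c s_init sE Fq.
apply/cvgr0Pnorm_lt => e e0.
have [L sL] := fejer_cvg s_fejer.
have M0 : 0 < `|s 0%N - q| + 1 by rewrite ltr_wpDl.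
have [eta eta0 H] := uniformly_convex_comb uc M0 e0 c0.
have s_le n : `|s n - q| <= `|s 0%N - q| + 1.
  elim: n => [|n IH]; first by rewrite lerDl.
  exact: le_trans (s_fejer n) IH.
(* Two consecutive distances within [eta / 2] of [L] differ by less than [eta]. *)
have eta20 : 0 < eta / 2 by rewrite divr_gt0.
have [N _ HN] := (cvgrPdist_lt _ _).1 sL _ eta20.
exists N => // n /= Nn; rewrite normr_id ltNge; apply/negP => es.
have := H _ (g n) (s n - q) (K (s n) - q) (s_le n) (g_c n) (lexx _).
have -> : (1 - g n) *: (s n - q) + g n *: (K (s n) - q) = s n.+1 - q.
  rewrite sE !scalerBr addrACA -opprD -[X in _ - X = _]scalerDl subrK.
  by rewrite scale1r.
rewrite opprB addrA subrK => /(_ _ es) s_drop.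
have {}s_drop : `|s n.+1 - q| <= `|s n - q| - eta.
  by apply: s_drop; rewrite -{1}Kq; exact: K_ne.
have := HN n Nn; have := HN n.+1 (leqW Nn).
rewrite /= !ltr_norml => /andP[? ?] /andP[? ?]; clear Kq; lra.
Qed.

(** The bound [|u n - K z| <= |u n - K (u n)| + |u n - z|] lets [opial_norm] apply with
    [t = K z]. *)
Lemma opial_fixed_point (R : realType) (Z : normedModType R) (W : set Z)
    (K : {fun W >-> W}) (u : nat -> Z) (z : Z) :
    opial_condition Z -> nonexpansive K -> (forall n, W (u n)) -> W z ->
    `|u n - K (u n)| @[n --> \oo] --> 0 ->
  weakly_cvg u z -> fixed_points K z.
Proof.
move=> opial K_ne Wu Wz uK uz; split => //.
apply: (opial_norm opial uz) => e e0.
have /cvgr0Pnorm_lt/(_ _ e0) := uK; apply: filterS => n /=.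
rewrite normr_id => ue; have := K_ne _ _ (Wu n) Wz.
have := ler_distD (K (u n)) (u n) (K z); lra.
Qed.

(** * Weak convergence of the two-step scheme *)

Theorem theorem3p3 (R : realType) (Z : completeNormedModType R)
    (Z_uc : uniformly_convex Z) (Z_opial : opial_condition Z)
    (W : set Z) (W_neq0 : W !=set0) (W_closed : closed W)
    (W_convex : convex_set W)
    (K : {fun W >-> W}) (K_ne : nonexpansive K)
    (FK_neq0 : fixed_points K !=set0)
    (a b : R) (a01 : 0 < a < 1) (b01 : 0 < b < 1)
    (alpha beta : nat -> R)
    (alpha_ab : forall n, a < alpha n < b)
    (beta_ab : forall n, a < beta n < b)
    (* the sequences are indexed from 0: [s 0] is the starting point s_1 *)
    (r s : nat -> Z) (s_init : W (s 0%N))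
    (rE : forall n, r n = (1 - beta n) *: s n + beta n *: K (s n))
    (sE : forall n, s n.+1 = (1 - alpha n) *: r n + alpha n *: K (s n)) :
  exists2 p : Z, fixed_points K p & weakly_cvg s p.
Proof.
pose g n := 1 - (1 - alpha n) * (1 - beta n).
have {rE sE r} sE' n : s n.+1 = (1 - g n) *: s n + g n *: K (s n).
  rewrite sE rE scalerDr !scalerA -addrA -scalerDl /g.
  by congr (_ *: _ + _ *: _); ring.
(* Here [g n >= alpha n > a] and [1 - g n = (1 - alpha n) * (1 - beta n) > (1 - b) ^+ 2]. *)
pose c := Num.min a ((1 - b) ^+ 2).
have c0 : 0 < c.
  by rewrite lt_min; apply/andP; split; [lra|rewrite exprn_gt0//; lra].
have g_c n : c <= g n <= 1 - c.
  have ca : c <= a by rewrite ge_min lexx.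
  have cb : c <= (1 - b) ^+ 2 by rewrite ge_min lexx orbT.
  have /andP[? ?] := alpha_ab n; have /andP[? ?] := beta_ab n.
  rewrite /g; apply/andP; split; nra.
have Ws := mann_sub W_convex c0 g_c s_init sE'.
have s_fejer q n Fq := mann_fejer W_convex K_ne c0 g_c s_init sE' (q := q) Fq n.
have [q Fq] := FK_neq0.
have s_reg :=
  mann_asymptotically_regular Z_uc W_convex K_ne c0 g_c s_init sE' Fq.
have s_bnd n : `|s n| <= `|s 0%N - q| + `|q|.
  rewrite -[s n](subrK q); apply: le_trans (ler_normD _ _) _; rewrite lerD2r.
  by elim: n => // n IH; exact: le_trans (s_fejer q n Fq) IH.
have W_mid : mid_closed W.
  split=> // x y Wx Wy; have -> : mid x y = (1 - 2^-1) *: x + 2^-1 *: y.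
    by rewrite /mid scalerDr; congr (_ *: _ + _); field.
  by apply: convex_set_comb => //; apply/andP; split; lra.
have cluster psi : inflating psi -> exists2 phi, inflating phi &
    exists2 p, fixed_points K p & weakly_cvg (s \o psi \o phi) p.
  move=> psi_infl.
  have [phi phi_infl [p [sp Hp]]] :=
    weakly_cvg_subsequence Z_uc (fun n => s_bnd (psi n)).
  exists phi => //; exists p => //.
  apply: (opial_fixed_point Z_opial K_ne _ _ _ sp) => /=.
  - by move=> n; exact: Ws.
  - by apply: Hp W_mid _ => n; exact: Ws.
  - have pp := inflating_cvg (inflating_comp psi_infl phi_infl).
    exact: (cvg_comp _ _ pp s_reg).
have unique phi phi' p p' : inflating phi -> inflating phi' ->
    fixed_points K p -> fixed_points K p' ->
    weakly_cvg (s \o phi) p -> weakly_cvg (s \o phi') p' -> p = p'.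
  (* The distances to both fixed points converge along the whole sequence, so Opial's condition is
     applied to the subsequence whose weak limit has the larger limiting distance. *)
  have one_sided (L L' : R) psi x x' :
      inflating psi -> weakly_cvg (s \o psi) x ->
      `|s n - x| @[n --> \oo] --> L -> `|s n - x'| @[n --> \oo] --> L' ->
      L' <= L -> x' = x.
    move=> psi_infl sx sL sL' LL; apply: (opial_norm Z_opial sx) => e e0.
    have e20 : 0 < e / 2 by rewrite divr_gt0.
    have pp := inflating_cvg psi_infl.
    have /cvgrPdist_lt/(_ _ e20) := cvg_comp _ _ pp sL.
    have /cvgrPdist_lt/(_ _ e20) := cvg_comp _ _ pp sL'.
    apply: filterS2 => n /=; rewrite !ltr_norml => /andP[? ?] /andP[? ?].
    by lra.
  move=> phi_infl phi'_infl Fp Fp' sp sp'.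
  have [L sL] := fejer_cvg (fun n => s_fejer p n Fp).
  have [L' sL'] := fejer_cvg (fun n => s_fejer p' n Fp').
  have [LL|/ltW LL] := leP L L'.
    exact: one_sided phi'_infl sp' sL' sL LL.
  by apply/esym; exact: one_sided phi_infl sp sL sL' LL.
have [phi phi_infl [p Fp sp]] := cluster id inflating_id.
(* Otherwise some subsequence keeps [f (s n)] at distance at least [e] from [f p], yet a further
   subsequence of it converges weakly to a fixed point, which must be [p]. *)
exists p => // f f_cont; apply/cvgrPdist_lt => e e0; apply: contrapT => nH.
have [psi psi_infl far] : exists2 psi, inflating psi &
    forall n, e <= `|f p - f (s (psi n))|.
  apply: (frequently_inflating (P := fun n => e <= `|f p - f (s n)|)) => H.
  apply: nH; apply: filterS H => n /negP.
  by rewrite -ltNge.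
have [chi chi_infl [p' Fp' sp']] := cluster psi psi_infl.
have pp' : p = p'.
  apply: (unique phi (psi \o chi)) Fp Fp' sp sp' => //.
  exact: inflating_comp.
rewrite -pp' in sp'.
have [N _ /(_ N (leqnn N))] := (cvgrPdist_lt _ _).1 (sp' f f_cont) _ e0.
by rewrite /= ltNge far.
Qed.
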